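(* Let $N\ge 1$ and $h\in\mathbb{C}$. Let $V=\mathrm{span}(l_i^j)_{1\le i,j\le N}$ and $W=\mathrm{span}(\partial_i^j)_{1\le i,j\le N}$ be complex vector spaces with the indicated bases, let $L=\|l_i^j\|$, $D=\|\partial_i^j\|$ be the corresponding generating matrices, and let $\sigma:T(W)\otimes T(V)\to T(V)\otimes T(W)$ be the permutation map determined by the permutation relations $$D_1L_2=L_2D_1+P_{12}+h\,D_1P_{12}.$$ Let $J_1\subset T(W)$ be the span of the entries of $D_1D_2-D_2D_1$, and let $J_2\subset T(V)$ be the span of the entries of $L_1L_2-L_2L_1-h(L_1P_{12}-P_{12}L_1)$. Then $\sigma$ is compatible with the defining relations of the algebras $A=T(W)/\langle J_1\rangle$ and $B=T(V)/\langle J_2\rangle=U(gl(N)_h)$, that is, $$\sigma(J_1\otimes V)\subset (\mathbb{C}1\oplus V)\otimes J_1\qquad\text{and}\qquad \sigma(W\otimes J_2)\subset J_2\otimes W .$$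
   Context: The ground field is $\mathbb{C}$. $T(V)=\bigoplus_{k\ge0}V^{\otimes k}$ is the free tensor algebra, and $\langle J\rangle$ is the two-sided ideal generated by $J$. For an $N\times N$ matrix $M=\|m_i^j\|$ ($i$ is the row index, $j$ the column index), $M_k$ denotes $M$ acting in the $k$-th tensor factor, e.g. $M_1=M\otimes I$, $M_2=I\otimes M$. $P$ is the flip on $\mathbb{C}^N\otimes\mathbb{C}^N$ with entries $P_{ik}^{js}=\delta_i^s\delta_k^j$, and $P_{12}$ is $P$ acting in factors 1 and 2. In components, the defining relations of $B$ are $l_i^jl_k^s-l_k^sl_i^j=h(l_i^s\delta_k^j-l_k^j\delta_i^s)$, and those of $A$ are $\partial_i^j\partial_k^s=\partial_k^s\partial_i^j$. Products such as $D_1L_2$ have entries $\partial_i^j\,l_k^s$. The permutation map $\sigma$ is the linear map defined as follows: each $\partial_i^j\otimes l_k^s$ (an entry of the left-hand side of the permutation relations) is sent to the corresponding entry of the right-hand side, viewed as an element of $T(V)\otimes T(W)$ (so that $L_2D_1$ has entries $l_k^s\otimes\partial_i^j$, the entries of $P_{12}$ are multiples of $1\otimes 1$, and the entries of $D_1P_{12}$ are of the form $1\otimes w$, $w\in W$); moreover $\sigma(1\otimes b)=b\otimes 1$ and $\sigma(a\otimes 1)=1\otimes a$ for all $a\in T(W)$, $b\in T(V)$; and $\sigma$ is extended to all of $T(W)\otimes T(V)$ by consecutive application of these rules, moving generators $\partial$ through generators $l$ one at a time, i.e. $\sigma(aa'\otimes b)$ is obtained by first permuting $a'$ with $b$ and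 then $a$ with the result, and $\sigma(a\otimes bb')$ by first permuting $a$ with $b$ and then the result with $b'$. *)

(* Defs.v *)
(* Free monoids and monoid algebras come from multinomials, the tensor product of
   matrices ( *t ) from real-closed. *)
From HB Require Import structures.
From mathcomp Require Import all_boot all_order all_algebra.
From mathcomp Require Import finmap reals.
From mathcomp.real_closed Require Import complex mxtens.
From mathcomp.multinomials Require Import monalg.

Set Implicit Arguments.
Unset Strict Implicit.
Unset Printing Implicit Defensive.

Import GRing.Theory.
Local Open Scope ring_scope.

Section PairMonom.
Variables M M' : monomType.
Implicit Types x y z : M * M'.

Definition pmone : M * M' := (mone, mone).
Definition pmmul x y : M * M' := (mmul x.1 y.1, mmul x.2 y.2).

Lemma pmmulA : associative pmmul.
Proof. by move=> x y z; rewrite /pmmul /= !mulmA. Qed.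

Lemma pmmul1m : left_id pmone pmmul.
Proof. by case=> x y; rewrite /pmmul /= !mul1m. Qed.

Lemma pmmulm1 : right_id pmone pmmul.
Proof. by case=> x y; rewrite /pmmul /= !mulm1. Qed.

Lemma pmmul_eq1 x y : pmmul x y = pmone -> x = pmone /\ y = pmone.
Proof.
case: x y => [x x'] [y y'] [] /unitm[-> ->] /unitm[-> ->]; by split.
Qed.

HB.instance Definition _ := Choice_isMonomialDef.Build (M * M')%type
  pmmulA pmmul1m pmmulm1 pmmul_eq1.
End PairMonom.

Definition words (X : choiceType) : monomType := {fmonom X}.
Definition words2 (X Y : choiceType) : monomType := (words X * words Y)%type.

Definition monoid_algebra (C : fieldType) (K : monomType) : Type := {malg C[K]}.

HB.instance Definition _ C K := GRing.Lalgebra.on (monoid_algebra C K).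

HB.lock Definition mono (C : fieldType) (K : monomType) (k : K) :
  monoid_algebra C K := << k >>.
Arguments mono C {K} k.

Definition coef (C : fieldType) (K : monomType) (a : monoid_algebra C K) (k : K) : C :=
  mcoeff k (a : {malg C[K]}).

Definition supp (C : fieldType) (K : monomType) (a : monoid_algebra C K) : seq K :=
  msupp (a : {malg C[K]}).

(* The tensor algebra of a vector space with basis X is the free algebra on X,
   with the words over X as a basis.  Likewise T(X) (x) T(Y) has the pairs of
   words as a basis, and its product is the componentwise one. *)
Notation talg C X := (monoid_algebra C (words X)).
Notation talg2 C X Y := (monoid_algebra C (words2 X Y)).

HB.lock Definition tens (C : fieldType) (X Y : choiceType)
    (a : talg C X) (b : talg C Y) : talg2 C X Y :=
  \sum_(u <- supp a) \sum_(v <- supp b)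
    (coef a u * coef b v) *: mono C ((u, v) : words2 X Y).
Arguments tens {C X Y} a b.

Notation "a \ox b" := (tens a b) (at level 40, left associativity) : ring_scope.

Definition letter (X : choiceType) (x : X) : words X := fmu x.

Variant lgen (N : nat) := LGen of 'I_N & 'I_N.
Variant dgen (N : nat) := DGen of 'I_N & 'I_N.
Arguments LGen {N}.
Arguments DGen {N}.

Definition lgen_pair N (l : lgen N) := let: LGen i j := l in (i, j).
Definition dgen_pair N (x : dgen N) := let: DGen i j := x in (i, j).

Lemma lgen_pairK N : cancel (@lgen_pair N) (fun p => LGen p.1 p.2).
Proof. by case. Qed.

Lemma dgen_pairK N : cancel (@dgen_pair N) (fun p => DGen p.1 p.2).
Proof. by case. Qed.

HB.instance Definition _ N := Choice.copy (lgen N) (can_type (@lgen_pairK N)).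
HB.instance Definition _ N := Choice.copy (dgen N) (can_type (@dgen_pairK N)).

Notation TV C N := (talg C (lgen N)).
Notation TW C N := (talg C (dgen N)).
Notation TVW C N := (talg2 C (lgen N) (dgen N)).
Notation TWV C N := (talg2 C (dgen N) (lgen N)).

Section Matrices.
Variables (C : fieldType) (N : nat).

Definition Lmx : 'M[TV C N]_N := \matrix_(i, j) mono C (letter (LGen i j)).
Definition Dmx : 'M[TW C N]_N := \matrix_(i, j) mono C (letter (DGen i j)).

Definition in1 (S : pzRingType) (M : 'M[S]_N) : 'M[S]_(N * N) := M *t 1%:M.
Definition in2 (S : pzRingType) (M : 'M[S]_N) : 'M[S]_(N * N) := 1%:M *t M.

(* The row index of an 'M_(N * N) encodes the pair of lower indices (i, k),
   its column index the pair of upper indices (j, s). *)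
Definition flipmx (S : pzRingType) : 'M[S]_(N * N) :=
  \matrix_(ik, js) (((mxtens_unindex ik).1 == (mxtens_unindex js).2)
                 && ((mxtens_unindex ik).2 == (mxtens_unindex js).1))%:R.
End Matrices.

Section Subspaces.
Variable C : fieldType.

Definition entry_span (E : lmodType C) (m n : nat) (M : 'M[E]_(m, n)) : E -> Prop :=
  fun x => exists c : 'M[C]_(m, n), x = \sum_i \sum_j c i j *: M i j.

Definition tens_sub (X Y : choiceType)
    (U : talg C X -> Prop) (U' : talg C Y -> Prop) : talg2 C X Y -> Prop :=
  fun t => exists (n : nat) (u : 'I_n -> talg C X) (u' : 'I_n -> talg C Y),
    [/\ forall i, U (u i), forall i, U' (u' i) & t = \sum_i u i \ox u' i].

Definition add_scalars (X : choiceType) (U : talg C X -> Prop) : talg C X -> Prop :=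
  fun x => exists (c : C) (u : talg C X), U u /\ x = c%:A + u.
End Subspaces.

Section Relations.
Variables (C : fieldType) (N : nat) (h : C).

Definition Vsp : TV C N -> Prop := entry_span (Lmx C N).
Definition Wsp : TW C N -> Prop := entry_span (Dmx C N).

Definition J1 : TW C N -> Prop :=
  let D1 := in1 (Dmx C N) in let D2 := in2 (Dmx C N) in
  entry_span (D1 *m D2 - D2 *m D1).

Definition J2 : TV C N -> Prop :=
  let L1 := in1 (Lmx C N) in let L2 := in2 (Lmx C N) in
  let P12 := flipmx N (TV C N) in
  entry_span (L1 *m L2 - L2 *m L1 - h%:A *: (L1 *m P12 - P12 *m L1)).

(* Entries of D1 L2 are in T(W) (x) T(V). *)
Definition perm_lhs : 'M[TWV C N]_(N * N) :=
  let D1 := in1 (map_mx (fun a => a \ox 1) (Dmx C N)) in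
  let L2 := in2 (map_mx (fun b => 1 \ox b) (Lmx C N)) in
  D1 *m L2.

(* Entries of the right-hand side are in T(V) (x) T(W). *)
Definition perm_rhs : 'M[TVW C N]_(N * N) :=
  let L2 := in2 (map_mx (fun b => b \ox 1) (Lmx C N)) in
  let D1 := in1 (map_mx (fun a => 1 \ox a) (Dmx C N)) in
  let P12 := flipmx N (TVW C N) in
  L2 *m D1 + P12 + h%:A *: (D1 *m P12).

(* The last two clauses are the consecutive application of the rules: if
   sigma (a' (x) b) = sum_i v_i (x) w_i, then permuting a with this result gives
   sum_i sigma (a (x) v_i) * (1 (x) w_i); and if sigma (a (x) b) is that sum, then
   permuting this result with b' gives sum_i (v_i (x) 1) * sigma (w_i (x) b').
   They have exactly one linear solution, see permutation_map_exists and
   permutation_map_unique below. *)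
Record permutation_map (sigma : {linear TWV C N -> TVW C N}) : Prop := {
  perm_gen : forall x y, sigma (perm_lhs x y) = perm_rhs x y;
  perm_1b : forall b, sigma (1 \ox b) = b \ox 1;
  perm_a1 : forall a, sigma (a \ox 1) = 1 \ox a;
  perm_consl : forall a a' b n (v : 'I_n -> TV C N) (w : 'I_n -> TW C N),
    sigma (a' \ox b) = \sum_i v i \ox w i ->
    sigma ((a * a') \ox b) = \sum_i sigma (a \ox v i) * (1 \ox w i);
  perm_consr : forall a b b' n (v : 'I_n -> TV C N) (w : 'I_n -> TW C N),
    sigma (a \ox b) = \sum_i v i \ox w i ->
    sigma (a \ox (b * b')) = \sum_i (v i \ox 1) * sigma (w i \ox b')
}.
End Relations.
Arguments Vsp : clear implicits.
Arguments Wsp : clear implicits.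
Arguments J1 : clear implicits.
Arguments J2 : clear implicits.

Section LinearExtension.
Variable C : fieldType.

Definition lin (E F : lmodType C) (f : E -> F) :=
  forall c x y, f (c *: x + y) = c *: f x + f y.

Section Lin.
Variables (E F G : lmodType C).

Lemma lin_raddf (f : {linear E -> F}) : lin f.
Proof. by move=> c x y; rewrite linearP. Qed.

Lemma lin_comp (f : F -> G) (g : E -> F) : lin f -> lin g -> lin (fun x => f (g x)).
Proof. by move=> lf lg c x y; rewrite lg lf. Qed.

Lemma lin_id : lin (fun x : E => x).
Proof. by []. Qed.

Lemma lin_add (f g : E -> F) : lin f -> lin g -> lin (fun x => f x + g x).
Proof. by move=> lf lg c x y; rewrite lf lg scalerDr addrACA. Qed.

Lemma lin_scale (a : C) (f : E -> F) : lin f -> lin (fun x => a *: f x).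
Proof. by move=> lf c x y; rewrite lf scalerDr !scalerA mulrC. Qed.

Lemma lin0 (f : E -> F) : lin f -> f 0 = 0.
Proof. by move=> lf; have := lf (-1) 0 0; rewrite !scaleN1r !addNr. Qed.

Lemma lin_sum (f : E -> F) (I : Type) (r : seq I) (g : I -> E) :
  lin f -> f (\sum_(i <- r) g i) = \sum_(i <- r) f (g i).
Proof.
move=> lf; elim: r => [|i r IHr]; first by rewrite !big_nil lin0.
by rewrite !big_cons -[g i]scale1r lf IHr !scale1r.
Qed.

Lemma lin_Z (f : E -> F) c x : lin f -> f (c *: x) = c *: f x.
Proof. by move=> lf; rewrite -[c *: x]addr0 lf lin0 // addr0. Qed.

Lemma lin_D (f : E -> F) x y : lin f -> f (x + y) = f x + f y.
Proof. by move=> lf; rewrite -[x in LHS]scale1r lf scale1r. Qed.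
End Lin.

Section Ext.
Variables (K : monomType) (F : lmodType C).
Implicit Types (f : K -> F) (g : monoid_algebra C K).

Definition ext f g : F := \sum_(k <- supp g) coef g k *: f k.

Lemma extEw f (d : {fset K}) (g : {malg C[K]}) : (msupp g `<=` d)%fset ->
  ext f g = \sum_(k <- d) g@_k *: f k.
Proof.
move=> le; rewrite /ext /supp /coef (big_fset_incl _ le) => //= x xd.
by move=> /mcoeff_outdom ->; rewrite scale0r.
Qed.

Lemma extU f k : ext f (mono C k) = f k.
Proof. by rewrite mono.unlock (extEw _ msuppU_le) big_seq_fset1 mcoeffUU scale1r. Qed.

Lemma lin_ext f : lin (ext f).
Proof.
move=> c x y; pose d := (msupp (x : {malg _[_]}) `|` msupp (y : {malg _[_]}))%fset.
have lex : (msupp (x : {malg _[_]}) `<=` d)%fset by apply: fsubsetUl.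
have ley : (msupp (y : {malg _[_]}) `<=` d)%fset by apply: fsubsetUr.
have lexy : (msupp (c *: x + y : {malg _[_]}) `<=` d)%fset.
  by apply: (fsubset_trans (msuppD_le _ _)); apply/fsetSU/msuppZ_le.
rewrite (extEw _ lex) (extEw _ ley) (extEw _ lexy) scaler_sumr -big_split /=.
by apply: eq_bigr => k _; rewrite mcoeffD mcoeffZ scalerDl scalerA.
Qed.

Lemma mono_decomp g : g = \sum_(k <- supp g) coef g k *: mono C k.
Proof.
rewrite [LHS](@monalgE K C); apply: eq_bigr => k _.
by apply/malgP => k'; rewrite mono.unlock [RHS]mcoeffZ !mcoeffU mulr_natr.
Qed.

Lemma lin_eq (f f' : monoid_algebra C K -> F) : lin f -> lin f' ->
  (forall k, f (mono C k) = f' (mono C k)) -> f =1 f'.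
Proof.
move=> lf lf' ff' g; rewrite [g]mono_decomp !lin_sum //.
by apply: eq_bigr => k _; rewrite !lin_Z // ff'.
Qed.
End Ext.

Section Mul.
Variable K : monomType.
Implicit Types (a b : monoid_algebra C K).

Lemma malg_scalerAr c a b : a * (c *: b) = c *: (a * b).
Proof.
apply/malgP=> k; rewrite [RHS]mcoeffZ.
rewrite [LHS](@mcoeffMlw _ _ (msupp (a : {malg _[_]})) (msupp (b : {malg _[_]}))) //.
  rewrite [X in _ * X](@mcoeffMlw _ _ (msupp (a : {malg _[_]}))
    (msupp (b : {malg _[_]}))) //.
  rewrite mulr_sumr; apply: eq_bigr => i _; rewrite mulr_sumr.
  by apply: eq_bigr => j _; rewrite mcoeffZ mulrnAr mulrCA.
exact: msuppZ_le.
Qed.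

Lemma lin_mull a (E : lmodType C) (f : E -> monoid_algebra C K) :
  lin f -> lin (fun x => a * f x).
Proof. by move=> lf c x y; rewrite lf mulrDr malg_scalerAr. Qed.

Lemma lin_mulr a (E : lmodType C) (f : E -> monoid_algebra C K) :
  lin f -> lin (fun x => f x * a).
Proof. by move=> lf c x y; rewrite lf mulrDl scalerAl. Qed.

Lemma monoM (k k' : K) : mono C k * mono C k' = mono C (mmul k k').
Proof.
rewrite mono.unlock [LHS](@malgM_def K C << k >> << k' >>) (@fgmulUU K C) mulr1.
by [].
Qed.

Lemma mono1 : 1 = mono C (mone : K).
Proof. by rewrite mono.unlock. Qed.
End Mul.

Section Tens.
Variables X Y : choiceType.
Implicit Types (a : talg C X) (b : talg C Y).

Lemma tensE a b :
  a \ox b = ext (fun u => ext (fun v => mono C ((u, v) : words2 X Y)) b) a.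
Proof.
rewrite tens.unlock.
apply: eq_bigr => u _; rewrite scaler_sumr; apply: eq_bigr => v _.
by rewrite scalerA.
Qed.

Lemma tensUU (u : words X) (v : words Y) :
  mono C u \ox mono C v = mono C ((u, v) : words2 X Y).
Proof. by rewrite tensE !extU. Qed.

Lemma lin_tensl b : lin (fun a => a \ox b).
Proof. by move=> c x y; rewrite !tensE lin_ext. Qed.

Lemma lin_tensr a : lin (fun b => a \ox b).
Proof.
move=> c x y; rewrite !tensE scaler_sumr -big_split /=.
by apply: eq_bigr => u _; rewrite lin_ext scalerDr !scalerA mulrC.
Qed.
End Tens.
End LinearExtension.

(* The interface of the monoid algebra.  The constructions below are carried out
   over this interface because conversion problems between concrete elements of
   {malg C[K]} are expensive. *)
Record monoid_algebra_spec (C : fieldType) (K : monomType) := MonoidAlgebraSpec {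
  spec_alg :> lalgType C;
  smono : K -> spec_alg;
  smonoM : forall k k', smono k * smono k' = smono (mmul k k');
  smono1 : 1 = smono mone;
  spec_scalerAr : forall (c : C) (a b : spec_alg), a * (c *: b) = c *: (a * b);
  sext : forall F : lmodType C, (K -> F) -> spec_alg -> F;
  lin_sext : forall (F : lmodType C) (f : K -> F), lin (sext f);
  sextU : forall (F : lmodType C) (f : K -> F) k, sext f (smono k) = f k;
  spec_decomp : forall a, exists n (c : 'I_n -> C) (k : 'I_n -> K),
    a = \sum_i c i *: smono (k i)
}.
Arguments smono {C K m}.

Section SpecTheory.
Variable C : fieldType.

Lemma slin_eq K (A : monoid_algebra_spec C K) (F : lmodType C) (f f' : A -> F) :
  lin f -> lin f' -> (forall k, f (smono k) = f' (smono k)) -> f =1 f'.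
Proof.
move=> lf lf' ff' a; have [n [c [k ->]]] := spec_decomp a; rewrite !lin_sum //.
by apply: eq_bigr => i _; rewrite !lin_Z // ff'.
Qed.

Lemma lin_smull K (A : monoid_algebra_spec C K) (a : A) (E : lmodType C)
  (f : E -> A) : lin f -> lin (fun x => a * f x).
Proof. by move=> lf c x y; rewrite lf mulrDr spec_scalerAr. Qed.

Lemma lin_smulr K (A : monoid_algebra_spec C K) (a : A) (E : lmodType C)
  (f : E -> A) : lin f -> lin (fun x => f x * a).
Proof. by move=> lf c x y; rewrite lf mulrDl scalerAl. Qed.

Lemma sext_sum K (A : monoid_algebra_spec C K) (F : lmodType C) (f g : K -> F)
  (c : C) (a : A) : sext (fun k => c *: f k + g k) a = c *: sext f a + sext g a.
Proof.
apply: (slin_eq (f := sext (m := A) (fun k => c *: f k + g k))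
  (f' := fun a : A => c *: sext f a + sext g a)) => [||k].
- exact: lin_sext.
- by apply: lin_add; [apply: lin_scale|]; exact: lin_sext.
by rewrite !sextU.
Qed.

Lemma eq_sext K (A : monoid_algebra_spec C K) (F : lmodType C) (f g : K -> F) (a : A) :
  f =1 g -> sext f a = sext g a.
Proof.
move=> fg; apply: (slin_eq (f := sext (m := A) f) (f' := sext (m := A) g)) => [||k].
- exact: lin_sext.
- exact: lin_sext.
by rewrite !sextU fg.
Qed.

Definition stens X Y (A : monoid_algebra_spec C (words X))
    (B : monoid_algebra_spec C (words Y))
    (S : monoid_algebra_spec C (words2 X Y)) (a : A) (b : B) : S :=
  sext (fun u => sext (fun v => smono ((u, v) : words2 X Y)) b) a.

Section STens.
Variables (X Y : choiceType).
Variables (A : monoid_algebra_spec C (words X)).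
Variables (B : monoid_algebra_spec C (words Y)).
Variables (S : monoid_algebra_spec C (words2 X Y)).

Lemma stensUU (u : words X) (v : words Y) :
  stens S (smono u : A) (smono v : B) = smono ((u, v) : words2 X Y).
Proof. by rewrite /stens !sextU. Qed.

Lemma lin_stensl (b : B) : lin (fun a : A => stens S a b).
Proof. exact: lin_sext. Qed.

Lemma lin_stensr (a : A) : lin (fun b : B => stens S a b).
Proof.
move=> c b b'; apply: (slin_eq (f := fun a : A => stens S a (c *: b + b'))
  (f' := fun a : A => c *: stens S a b + stens S a b')) => [||u].
- exact: lin_stensl.
- by apply: lin_add; [apply: lin_scale|]; exact: lin_stensl.
by rewrite /stens !sextU lin_sext.
Qed.
End STens.
End SpecTheory.

Definition seq_of (A : choiceType) (u : words A) : seq A := (u : {fmonom A}).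

Lemma seq_ofM (A : choiceType) (u u' : words A) :
  seq_of (mmul u u') = seq_of u ++ seq_of u'.
Proof. exact: fmM. Qed.

Lemma seq_of1 (A : choiceType) : seq_of (mone : words A) = [::].
Proof. exact: fm1. Qed.

Lemma seq_ofU (A : choiceType) (x : A) : seq_of (letter x) = [:: x].
Proof. exact: fmU. Qed.

Lemma words_ind (A : choiceType) (P : words A -> Prop) :
  P mone -> (forall (x : A) u, P u -> P (mmul (letter x) u)) -> forall u, P u.
Proof.
move=> P0 PS [u]; elim: u => [|x u /PS - /(_ x)].
  by have -> : FMonom [::] = (mone : words A) by rewrite -fmoneE.
by congr P; apply/val_inj; rewrite /= fmM fmU.
Qed.

Section SpecPermutation.
Variables (C : fieldType) (X Y : choiceType).
Variables (c1 c2 : X -> Y -> C) (upd : X -> Y -> X).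
Variables (A : monoid_algebra_spec C (words Y)).
Variables (B : monoid_algebra_spec C (words X)).
Variables (S : monoid_algebra_spec C (words2 X Y)).
Variables (T : monoid_algebra_spec C (words2 Y X)).
Implicit Types (x : X) (l : Y) (t : T) (a : B) (b : A).

Local Notation tS a b := (@stens C X Y B A S a b).
Local Notation tT a b := (@stens C Y X A B T a b).

Record spec_permutation (sigma : S -> T) : Prop := {
  sperm_lin : lin sigma;
  sperm_gen : forall x l, sigma (tS (smono (letter x)) (smono (letter l))) =
    tT (smono (letter l)) (smono (letter x)) + c1 x l *: tT 1 1
    + c2 x l *: tT 1 (smono (letter (upd x l)));
  sperm_1b : forall b : A, sigma (tS (1 : B) b) = tT b (1 : B);
  sperm_a1 : forall a : B, sigma (tS a (1 : A)) = tT (1 : A) a;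
  sperm_consl : forall (a a' : B) (b : A) n (v : 'I_n -> A) (w : 'I_n -> B),
    sigma (tS a' b) = \sum_i tT (v i) (w i) ->
    sigma (tS (a * a') b) = \sum_i sigma (tS a (v i)) * tT (1 : A) (w i);
  sperm_consr : forall (a : B) (b b' : A) n (v : 'I_n -> A) (w : 'I_n -> B),
    sigma (tS a b) = \sum_i tT (v i) (w i) ->
    sigma (tS a (b * b')) = \sum_i tT (v i) (1 : B) * sigma (tS (w i) b')
}.

Let vw (v : words Y) (w : words X) : T := smono (v, w).
Let vv v := vw v mone.
Let ww w := vw mone w.

Fixpoint step1 (v : seq Y) (x : X) : T :=
  if v is l :: v' then
    vv (letter l) * step1 v' x + c1 x l *: vv (FMonom v')
    + c2 x l *: step1 v' (upd x l)
  else ww (letter x).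

Definition step x : T -> T :=
  sext (fun p : words2 Y X => step1 (seq_of p.1) x * ww p.2).
Definition steps (w : words X) t : T := foldr step t (seq_of w).
Definition permr t u : T :=
  sext (fun p : words2 Y X => vv p.1 * steps p.2 u) t.
Definition perm_fun : S -> T :=
  sext (fun p : words2 X Y => steps p.1 (vv p.2)).

Lemma lin_step x : lin (step x). Proof. exact: lin_sext. Qed.

Lemma lin_steps w : lin (steps w).
Proof.
rewrite /steps; elim: (seq_of w) => [|x s IHs]; first exact: lin_id.
exact: (lin_comp (lin_step x) IHs).
Qed.

Lemma lin_permrl u : lin (permr^~ u). Proof. exact: lin_sext. Qed.

Lemma mulVW v w : vv v * ww w = vw v w.
Proof. by rewrite /vv /ww /vw smonoM /mmul /= /pmmul /= mulm1 mul1m. Qed.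

Lemma mulVP v v' w : vv v * vw v' w = vw (mmul v v') w.
Proof. by rewrite /vv /vw smonoM /mmul /= /pmmul /= mul1m. Qed.

Lemma mulPW v w w' : vw v w * ww w' = vw v (mmul w w').
Proof. by rewrite /ww /vw smonoM /mmul /= /pmmul /= mulm1. Qed.

Lemma mulVV v v' : vv v * vv v' = vv (mmul v v').
Proof. exact: mulVP. Qed.

Lemma mulWW w w' : ww w * ww w' = ww (mmul w w').
Proof. exact: mulPW. Qed.

Lemma vv1 : 1 = vv mone. Proof. exact: smono1. Qed.
Lemma ww1 : 1 = ww mone. Proof. exact: smono1. Qed.

Lemma step_vw x v w : step x (vw v w) = step1 (seq_of v) x * ww w.
Proof. exact: sextU. Qed.

Lemma permr_vw v w u : permr (vw v w) u = vv v * steps w u.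
Proof. exact: sextU. Qed.

Lemma steps1 t : steps mone t = t.
Proof. by rewrite /steps seq_of1. Qed.

Lemma stepsM w w' t : steps (mmul w w') t = steps w (steps w' t).
Proof. by rewrite /steps seq_ofM foldr_cat. Qed.

Lemma stepsU x t : steps (letter x) t = step x t.
Proof. by rewrite /steps seq_ofU. Qed.

Lemma lin_eqT (F : lmodType C) (f f' : T -> F) : lin f -> lin f' ->
  (forall v w, f (vw v w) = f' (vw v w)) -> f =1 f'.
Proof. by move=> lf lf' e; apply: slin_eq => // -[v w]; apply: e. Qed.

Lemma stepV x l t : step x (vv (letter l) * t) =
  vv (letter l) * step x t + c1 x l *: t + c2 x l *: step (upd x l) t.
Proof.
apply: (lin_eqT (f := fun t => step x (vv (letter l) * t))
  (f' := fun t => _ + _ + _)).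
- apply: (lin_comp (lin_step x)); exact/lin_smull/lin_id.
- apply: lin_add; last exact/lin_scale/lin_step.
  by apply: lin_add; [exact/lin_smull/lin_step | exact/lin_scale/lin_id].
move=> v w; rewrite mulVP !step_vw seq_ofM seq_ofU /=.
have -> : FMonom (seq_of v) = v by case: (v).
by rewrite -mulVW !mulrDl -!scalerAl mulrA.
Qed.

Lemma stepW x w t : step x (t * ww w) = step x t * ww w.
Proof.
apply: (lin_eqT (f := fun t => step x (t * ww w)) (f' := fun t => _ * _)).
- apply: (lin_comp (lin_step x)); exact/lin_smulr/lin_id.
- exact/lin_smulr/lin_step.
by move=> v w'; rewrite mulPW !step_vw -mulrA mulWW.
Qed.

Lemma stepsW w' w t : steps w' (t * ww w) = steps w' t * ww w.
Proof. by rewrite /steps; elim: (seq_of w') => //= x s ->; rewrite stepW. Qed.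

Lemma permrV v t u : permr (vv v * t) u = vv v * permr t u.
Proof.
apply: (lin_eqT (f := fun t => permr (vv v * t) u) (f' := fun t => _ * _)).
- apply: (lin_comp (lin_permrl u)); exact/lin_smull/lin_id.
- exact/lin_smull/lin_permrl.
by move=> v' w'; rewrite mulVP !permr_vw mulrA mulVV.
Qed.

Lemma permrW w t u : permr (t * ww w) u = permr t (steps w u).
Proof.
apply: (lin_eqT (f := fun t => permr (t * ww w) u) (f' := fun t => permr t _)).
- apply: (lin_comp (lin_permrl u)); exact/lin_smulr/lin_id.
- exact/lin_permrl.
by move=> v' w'; rewrite mulPW !permr_vw stepsM.
Qed.

Lemma permr_vv v u : permr (vv v) u = vv v * u.
Proof. by rewrite permr_vw steps1. Qed.

Lemma step_vv x v : step x (vv v) = step1 (seq_of v) x.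
Proof. by rewrite step_vw -ww1 mulr1. Qed.

Lemma step_permr1 x v u : step x (vv v * u) = permr (step x (vv v)) u.
Proof.
elim/words_ind: v x u => [|l v IHv] x u.
  by rewrite step_vv seq_of1 /= permr_vw stepsU -vv1 !mul1r.
rewrite -mulVV -mulrA !stepV !IHv.
rewrite !(lin_D _ _ (lin_permrl u)) !(lin_Z _ _ (lin_permrl u)).
by rewrite permrV permr_vv.
Qed.

Lemma step_permr x t u : step x (permr t u) = permr (step x t) u.
Proof.
apply: (lin_eqT (f := fun t => step x (permr t u)) (f' := fun t => permr _ u)).
- exact: (lin_comp (lin_step x) (lin_permrl u)).
- exact: (lin_comp (lin_permrl u) (lin_step x)).
by move=> v w; rewrite permr_vw step_permr1 -permrW -stepW mulVW.
Qed.

Lemma steps_permr w t u : steps w (permr t u) = permr (steps w t) u.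
Proof. by rewrite /steps; elim: (seq_of w) => //= x s ->; rewrite step_permr. Qed.

Lemma lin_perm_fun : lin perm_fun. Proof. exact: lin_sext. Qed.

Lemma perm_funU (w : words X) (v : words Y) :
  perm_fun (tS (smono w : B) (smono v : A)) = steps w (vv v).
Proof. by rewrite stensUU; exact: sextU. Qed.

Lemma steps_1 w : steps w 1 = ww w.
Proof.
elim/words_ind: w => [|x w IHw]; first by rewrite steps1 ww1.
by rewrite stepsM IHw stepsU [LHS]step_vw seq_of1 /= mulWW.
Qed.

Let lin_pl (b : A) : lin (fun a : B => perm_fun (tS a b)).
Proof. exact: (lin_comp lin_perm_fun (lin_stensl S b)). Qed.

Let lin_pr (a : B) : lin (fun b : A => perm_fun (tS a b)).
Proof. exact: (lin_comp lin_perm_fun (lin_stensr S a)). Qed.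

Lemma perm_fun1b (b : A) : perm_fun (tS (1 : B) b) = tT b (1 : B).
Proof.
apply: (slin_eq (f := fun b : A => perm_fun (tS (1 : B) b))
  (f' := fun b => tT b (1 : B))) => [||v]; first exact: lin_pr.
  exact: lin_stensl.
by rewrite !smono1 perm_funU steps1 stensUU.
Qed.

Lemma perm_funa1 (a : B) : perm_fun (tS a (1 : A)) = tT (1 : A) a.
Proof.
apply: (slin_eq (f := fun a : B => perm_fun (tS a (1 : A)))
  (f' := fun a => tT (1 : A) a)) => [||w]; first exact: lin_pl.
  exact: lin_stensr.
by rewrite !smono1 perm_funU -vv1 steps_1 stensUU.
Qed.

Let opl (a : B) : T -> T :=
  sext (fun p : words2 Y X => perm_fun (tS a (smono p.1 : A)) * ww p.2).
Let opr (b : A) : T -> T :=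
  sext (fun p : words2 Y X => vv p.1 * perm_fun (tS (smono p.2 : B) b)).

Let lin_opl t : lin (opl^~ t).
Proof.
move=> c a a'; rewrite -sext_sum.
apply: eq_sext => k.
by rewrite lin_pl mulrDl scalerAl.
Qed.

Let lin_opr t : lin (opr^~ t).
Proof.
move=> c a a'; rewrite -sext_sum.
apply: eq_sext => k.
by rewrite lin_pr mulrDr spec_scalerAr.
Qed.

Let lin_opl2 a : lin (opl a). Proof. exact: lin_sext. Qed.
Let lin_opr2 b : lin (opr b). Proof. exact: lin_sext. Qed.

Let opl_tens a (v : A) (w : B) :
  opl a (tT v w) = perm_fun (tS a v) * tT (1 : A) w.
Proof.
apply: (slin_eq (f := fun v => opl a (tT v w))
  (f' := fun v => perm_fun (tS a v) * tT (1 : A) w)).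
- apply: (lin_comp (lin_opl2 _) (lin_stensl T w)).
- exact/lin_smulr/lin_pr.
move=> {}v; apply: (slin_eq (f := fun w => opl a (tT _ w))
  (f' := fun w => _ * tT (1 : A) w)).
- apply: (lin_comp (lin_opl2 _) (lin_stensr T _)).
- exact/lin_smull/lin_stensr.
by move=> {}w; rewrite stensUU [LHS]sextU smono1 stensUU.
Qed.

Let opr_tens b (v : A) (w : B) :
  opr b (tT v w) = tT v (1 : B) * perm_fun (tS w b).
Proof.
apply: (slin_eq (f := fun v => opr b (tT v w))
  (f' := fun v => tT v (1 : B) * perm_fun (tS w b))).
- apply: (lin_comp (lin_opr2 _) (lin_stensl T w)).
- exact/lin_smulr/lin_stensl.
move=> {}v; apply: (slin_eq (f := fun w => opr b (tT _ w))
  (f' := fun w => _ * perm_fun (tS w b))).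
- apply: (lin_comp (lin_opr2 _) (lin_stensr T _)).
- exact/lin_smull/lin_pl.
by move=> {}w; rewrite stensUU [LHS]sextU smono1 stensUU.
Qed.

Lemma perm_funMl (a a' : B) (b : A) :
  perm_fun (tS (a * a') b) = opl a (perm_fun (tS a' b)).
Proof.
apply: (slin_eq (f := fun a => perm_fun (tS (a * a') b))
  (f' := fun a => opl a (perm_fun (tS a' b)))) => [||{}a].
- by apply: (lin_comp (lin_pl b)); exact/lin_smulr/lin_id.
- exact: lin_opl.
apply: (slin_eq (f := fun a' => perm_fun (tS (_ * a') b))
  (f' := fun a' => opl _ (perm_fun (tS a' b)))) => [||{}a'].
- by apply: (lin_comp (lin_pl b)); exact/lin_smull/lin_id.
- exact: (lin_comp (lin_opl2 _) (lin_pl b)).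
apply: (slin_eq (f := fun b => perm_fun (tS _ b))
  (f' := fun b => opl _ (perm_fun (tS _ b)))) => [||{}b].
- exact: lin_pr.
- exact: (lin_comp (lin_opl2 _) (lin_pr _)).
rewrite smonoM !perm_funU stepsM; move: (steps a' _) => t.
apply: (lin_eqT (lin_steps a) (lin_opl2 _)) => v w.
by rewrite [RHS]sextU perm_funU -stepsW mulVW.
Qed.

Lemma perm_funMr (a : B) (b b' : A) :
  perm_fun (tS a (b * b')) = opr b' (perm_fun (tS a b)).
Proof.
apply: (slin_eq (f := fun b' => perm_fun (tS a (b * b')))
  (f' := fun b' => opr b' (perm_fun (tS a b)))) => [||{}b'].
- by apply: (lin_comp (lin_pr a)); exact/lin_smull/lin_id.
- exact: lin_opr.
apply: (slin_eq (f := fun b => perm_fun (tS a (b * _)))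
  (f' := fun b => opr _ (perm_fun (tS a b)))) => [||{}b].
- by apply: (lin_comp (lin_pr a)); exact/lin_smulr/lin_id.
- exact: (lin_comp (lin_opr2 _) (lin_pr a)).
apply: (slin_eq (f := fun a => perm_fun (tS a _))
  (f' := fun a => opr _ (perm_fun (tS a _)))) => [||{}a].
- exact: lin_pl.
- exact: (lin_comp (lin_opr2 _) (lin_pl _)).
rewrite smonoM !perm_funU -mulVV -permr_vv steps_permr.
move: (steps a _) => t.
apply: (lin_eqT (lin_permrl _) (lin_opr2 _)) => v w.
by rewrite permr_vw [RHS]sextU perm_funU.
Qed.

Lemma spec_permutation_exists : spec_permutation perm_fun.
Proof.
split.
- exact: lin_perm_fun.
- move=> x l; rewrite perm_funU stepsU -[vv _]mulr1 stepV.
  by rewrite vv1 !step_vv seq_of1 /= mulVW !smono1 !stensUU.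
- exact: perm_fun1b.
- exact: perm_funa1.
- move=> a a' b n v w e; rewrite perm_funMl e (lin_sum _ _ (lin_opl2 a)).
  by apply: eq_bigr => i _; rewrite opl_tens.
- move=> a b b' n v w e; rewrite perm_funMr e (lin_sum _ _ (lin_opr2 b')).
  by apply: eq_bigr => i _; rewrite opr_tens.
Qed.

Lemma stens_decomp t : exists n (v : 'I_n -> A) (w : 'I_n -> B),
  t = \sum_i tT (v i) (w i).
Proof.
have [n [c [k ->]]] := spec_decomp t.
exists n, (fun i => c i *: smono (k i).1), (fun i => smono (k i).2).
apply: eq_bigr => i _.
by rewrite (lin_Z _ _ (lin_stensl T _)) stensUU; case: (k i).
Qed.

Lemma spec_permutation_unique (sigma tau : S -> T) :
  spec_permutation sigma -> spec_permutation tau -> sigma =1 tau.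
Proof.
move=> Hs Ht; apply: slin_eq => [||[w v]]; [exact: sperm_lin..|].
rewrite -(stensUU B A); elim/words_ind: w v => [|x w IHw] v.
  by rewrite -smono1 (sperm_1b Hs) (sperm_1b Ht).
have gen1 (y : X) (v' : words Y) :
  sigma (tS (smono (letter y) : B) (smono v' : A)) =
  tau (tS (smono (letter y) : B) (smono v' : A)).
  elim/words_ind: v' y => [|l v' IHv] y.
    by rewrite -smono1 (sperm_a1 Hs) (sperm_a1 Ht).
  have gE (rho : S -> T) : spec_permutation rho ->
    rho (tS (smono (letter y) : B) (smono (letter l) : A)) = \sum_(i < 3)
      tT (nth 0 [:: smono (letter l); c1 y l *: 1; c2 y l *: 1] i : A)
         (nth 0 [:: smono (letter y); 1; smono (letter (upd y l))] i : B).
    move=> Hr; rewrite (sperm_gen Hr) !big_ord_recl big_ord0 /= addr0 addrA.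
    by rewrite !(lin_Z _ _ (lin_stensl T _)).
  rewrite -smonoM (sperm_consr Hs _ (gE _ Hs)) (sperm_consr Ht _ (gE _ Ht)).
  apply: eq_bigr => i _; congr (_ * _).
  case: i => -[|[|[|//]]] /= _; rewrite ?IHv //.
  by rewrite (sperm_1b Hs) (sperm_1b Ht).
have [n [a [b e]]] := stens_decomp (sigma (tS (smono w : B) (smono v : A))).
rewrite -smonoM (sperm_consl Hs _ e); move: e; rewrite IHw => e.
rewrite (sperm_consl Ht _ e); apply: eq_bigr => i _; congr (_ * _).
apply: (slin_eq (f := fun v => sigma (tS _ v)) (f' := fun v => tau (tS _ v))).
- exact: (lin_comp (sperm_lin Hs) (lin_stensr S _)).
- exact: (lin_comp (sperm_lin Ht) (lin_stensr S _)).
exact: gen1.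
Qed.
End SpecPermutation.

Section Concrete.
Variable C : fieldType.

Lemma ma_decomp (K : monomType) (t : monoid_algebra C K) :
  exists n (c : 'I_n -> C) (k : 'I_n -> K), t = \sum_i c i *: mono C (k i).
Proof.
exists (size (supp t)), (fun i => coef t (tnth (in_tuple (supp t)) i)),
  (fun i => tnth (in_tuple (supp t)) i).
by rewrite [LHS]mono_decomp big_tnth.
Qed.

Definition ma_spec (K : monomType) : monoid_algebra_spec C K :=
  @MonoidAlgebraSpec C K (monoid_algebra C K) (@mono C K) (@monoM C K)
    (@mono1 C K) (@malg_scalerAr C K) (@ext C K) (@lin_ext C K) (@extU C K)
    (@ma_decomp K).

Lemma stens_tens X Y (a : talg C X) (b : talg C Y) :
  stens (A := ma_spec (words X)) (B := ma_spec (words Y)) (ma_spec (words2 X Y)) a b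
  = a \ox b.
Proof. by rewrite tensE. Qed.
End Concrete.

Section PermutationMap.
Variables (C : fieldType) (N : nat) (h : C).
Notation X := (dgen N : choiceType).
Notation Y := (lgen N : choiceType).
Implicit Types (x : dgen N) (l : lgen N).


Lemma in1E (S : pzRingType) (M : 'M[S]_N) (i j k s : 'I_N) :
  in1 M (mxtens_index (i, k)) (mxtens_index (j, s)) = M i j *+ (k == s).
Proof. by rewrite tensmxE !mxE mulr_natr. Qed.

Lemma in2E (S : pzRingType) (M : 'M[S]_N) (i j k s : 'I_N) :
  in2 M (mxtens_index (i, k)) (mxtens_index (j, s)) = M k s *+ (i == j).
Proof. by rewrite tensmxE !mxE mulr_natl. Qed.

Lemma flipmxE (S : pzRingType) (i j k s : 'I_N) :
  flipmx N S (mxtens_index (i, k)) (mxtens_index (j, s)) =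
  ((i == s) && (k == j))%:R.
Proof. by rewrite mxE !mxtens_indexK. Qed.

Lemma sum_mxtens (S : nmodType) (F : 'I_(N * N) -> S) :
  \sum_p F p = \sum_i \sum_j F (mxtens_index (i, j)).
Proof.
rewrite pair_big /= (reindex (@mxtens_index N N)) /=.
  by apply: eq_bigr => -[i j].
by exists (@mxtens_unindex N N) => p _; rewrite (mxtens_indexK, mxtens_unindexK).
Qed.

Lemma sum_delta (S : nmodType) (F : 'I_N -> S) (j : 'I_N) :
  \sum_i F i *+ (i == j) = F j.
Proof.
rewrite (bigD1 j) //= eqxx mulr1n big1 ?addr0 // => i /negPf ->.
by rewrite mulr0n.
Qed.

Lemma in1_mulE (S : pzRingType) (M : 'M[S]_N) (A : 'M[S]_(N * N)) (i j k s : 'I_N) :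
  (in1 M *m A) (mxtens_index (i, k)) (mxtens_index (j, s)) =
  \sum_p M i p * A (mxtens_index (p, k)) (mxtens_index (j, s)).
Proof.
rewrite mxE sum_mxtens; apply: eq_bigr => p _.
rewrite -[RHS](sum_delta
  (fun q => M i p * A (mxtens_index (p, q)) (mxtens_index (j, s)))).
by apply: eq_bigr => q _; rewrite in1E mulrnAl eq_sym.
Qed.

Lemma in2_mulE (S : pzRingType) (M : 'M[S]_N) (A : 'M[S]_(N * N)) (i j k s : 'I_N) :
  (in2 M *m A) (mxtens_index (i, k)) (mxtens_index (j, s)) =
  \sum_q M k q * A (mxtens_index (i, q)) (mxtens_index (j, s)).
Proof.
rewrite mxE sum_mxtens exchange_big; apply: eq_bigr => q _ /=.
rewrite -[RHS](sum_delta
  (fun p => M k q * A (mxtens_index (p, q)) (mxtens_index (j, s)))).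
by apply: eq_bigr => p _; rewrite in2E mulrnAl eq_sym.
Qed.

Lemma tens_mulU (X' Y' : choiceType) (a : words X') (b : words Y') :
  (mono C a \ox 1) * (1 \ox mono C b) = mono C a \ox mono C b.
Proof.
have -> : mono C a \ox 1 = mono C (a, mone) :> talg2 C X' Y' by rewrite mono1 tensUU.
have -> : 1 \ox mono C b = mono C (mone, b) :> talg2 C X' Y' by rewrite mono1 tensUU.
by rewrite monoM tensUU /mmul /= /pmmul /= mulm1 mul1m.
Qed.

Lemma LmapE (S : Type) (f : TV C N -> S) i j :
  map_mx f (Lmx C N) i j = f (mono C (letter (LGen i j))).
Proof. by rewrite !mxE. Qed.

Lemma DmapE (S : Type) (f : TW C N -> S) i j :
  map_mx f (Dmx C N) i j = f (mono C (letter (DGen i j))).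
Proof. by rewrite !mxE. Qed.

Lemma tens11 X' Y' : (1 : talg C X') \ox (1 : talg C Y') = 1.
Proof. by rewrite !mono1 tensUU. Qed.

Lemma perm_lhsE (i j k s : 'I_N) :
  perm_lhs C N (mxtens_index (i, k)) (mxtens_index (j, s)) =
  mono C (letter (DGen i j)) \ox mono C (letter (LGen k s)).
Proof.
rewrite /perm_lhs in1_mulE.
under eq_bigr do rewrite in2E mulrnAr.
by rewrite sum_delta DmapE LmapE tens_mulU.
Qed.

Definition cst1 x l : C :=
  let: DGen i j := x in let: LGen k s := l in ((i == s) && (k == j))%:R.
Definition cst2 x l : C :=
  let: DGen i j := x in let: LGen k s := l in h * (k == j)%:R.
Definition upd x l : dgen N :=
  let: DGen i j := x in let: LGen k s := l in DGen i s.

Lemma addmxE (S : nmodType) m n (A B : 'M[S]_(m, n)) p q :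
  (A + B) p q = A p q + B p q.
Proof. by rewrite mxE. Qed.

Lemma scalemxE (S : pzRingType) m n (a : S) (A : 'M[S]_(m, n)) p q :
  (a *: A) p q = a * A p q.
Proof. by rewrite mxE. Qed.

Lemma perm_rhsE (i j k s : 'I_N) :
  perm_rhs N h (mxtens_index (i, k)) (mxtens_index (j, s)) =
  mono C (letter (LGen k s)) \ox mono C (letter (DGen i j)) + cst1 (DGen i j) (LGen k s) *: 1
   + cst2 (DGen i j) (LGen k s) *: (1 \ox mono C (letter (DGen i s))).
Proof.
rewrite /perm_rhs addmxE addmxE scalemxE flipmxE; congr (_ + _ + _).
- rewrite in2_mulE; under eq_bigr do rewrite in1E mulrnAr.
  by rewrite sum_delta DmapE LmapE tens_mulU.
- by rewrite scaler_nat.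
rewrite in1_mulE (bigD1 s) //= flipmxE eqxx big1 => [|p /negPf np].
  rewrite addr0 DmapE -scalerAl mul1r -scalerA; congr (_ *: _).
  by rewrite scaler_nat mulr_natr.
by rewrite flipmxE np mulr0.
Qed.

Lemma permutation_map_spec (sigma : {linear TWV C N -> TVW C N}) :
  permutation_map h sigma <->
  @spec_permutation C X Y cst1 cst2 upd (ma_spec C (words Y))
    (ma_spec C (words X)) (ma_spec C (words2 X Y)) (ma_spec C (words2 Y X)) sigma.
Proof.
split=> [[Hg H1b Ha1 Hl Hr]|[_ Hg H1b Ha1 Hl Hr]]; split.
- exact: lin_raddf.
- move=> [i j] [k s]; have := Hg (mxtens_index (i, k)) (mxtens_index (j, s)).
  rewrite perm_lhsE perm_rhsE -(tens11 Y X) -!stens_tens.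
  exact.
- by move=> b; rewrite !stens_tens; exact: H1b.
- by move=> a; rewrite !stens_tens; exact: Ha1.
- move=> a a' b n v w; rewrite !stens_tens => e.
  under eq_bigr do rewrite !stens_tens.
  by apply: Hl; rewrite e; apply: eq_bigr => i _; rewrite stens_tens.
- move=> a b b' n v w; rewrite !stens_tens => e.
  under eq_bigr do rewrite !stens_tens.
  by apply: Hr; rewrite e; apply: eq_bigr => i _; rewrite stens_tens.
- move=> x y; case: (mxtens_indexP x) => i k; case: (mxtens_indexP y) => j s.
  rewrite perm_lhsE perm_rhsE -(tens11 Y X) -!stens_tens.
  exact: (Hg (DGen i j) (LGen k s)).
- by move=> b; have := H1b b; rewrite !stens_tens.
- by move=> a; have := Ha1 a; rewrite !stens_tens.
- move=> a a' b n v w e; rewrite -(stens_tens (a * a') b) (Hl a a' b n v w).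
    by apply: eq_bigr => i _; rewrite !stens_tens.
  by rewrite stens_tens e; apply: eq_bigr => i _; rewrite stens_tens.
- move=> a b b' n v w e; rewrite -(stens_tens a (b * b')) (Hr a b b' n v w).
    by apply: eq_bigr => i _; rewrite !stens_tens.
  by rewrite stens_tens e; apply: eq_bigr => i _; rewrite stens_tens.
Qed.

Definition perm_fun_conc : TWV C N -> TVW C N :=
  @perm_fun C X Y cst1 cst2 upd (ma_spec C (words2 X Y)) (ma_spec C (words2 Y X)).

Lemma lin_perm_fun_conc : lin perm_fun_conc.
Proof.
exact: (@lin_perm_fun C X Y cst1 cst2 upd (ma_spec C (words2 X Y))
  (ma_spec C (words2 Y X))).
Qed.

HB.instance Definition _ := GRing.isLinear.Build C (TWV C N) (TVW C N) *:%R
  perm_fun_conc lin_perm_fun_conc.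

Lemma permutation_map_exists :
  exists sigma : {linear TWV C N -> TVW C N}, permutation_map h sigma.
Proof.
exists perm_fun_conc; apply/permutation_map_spec.
exact: spec_permutation_exists.
Qed.

Lemma permutation_map_unique (sigma tau : {linear TWV C N -> TVW C N}) :
  permutation_map h sigma -> permutation_map h tau -> sigma =1 tau.
Proof.
move=> /permutation_map_spec Hs /permutation_map_spec Ht.
exact: (spec_permutation_unique Hs Ht).
Qed.
End PermutationMap.

(* Main.v *)
Require Import Defs.
From mathcomp Require Import all_boot all_order all_algebra.
From mathcomp Require Import reals ring.
From mathcomp.real_closed Require Import complex mxtens.
From mathcomp.multinomials Require Import monalg.

(* Write x' = d_i^s for x = d_i^j moved through l = l_k^s, so that
     sigma (x (x) l) = l (x) x + c1(x, l) + c2(x, l) x'.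
   Moving the two factors of a commutator one after the other, the terms coming
   from the constants c1 cancel and
     sigma ([x, y] (x) l) = l (x) [x, y] + c2(x, l) [x', y] + c2(y, l) [x, y'],
   which is in (C1 + V) (x) J1.  For an entry r of the relations of B, the extra
   terms of the quadratic part of r cancel exactly against those of its linear
   part, so that sigma (x (x) r) = r (x) x: on W (x) J2, sigma is the plain flip. *)

Set Implicit Arguments.
Unset Strict Implicit.
Unset Printing Implicit Defensive.

Import GRing.Theory.
Local Open Scope ring_scope.

(** * Coordinates in the monomial basis *)

Section SpecCoefficients.
Variables (C : fieldType) (K : monomType) (A : monoid_algebra_spec C K).
Implicit Types (x y : A) (k : K).

(* Coordinates reduce identities of vectors to identities in C, which ring proves. *)
Definition scoef k x : C := coef (sext (m := A) (@mono C K) x) k.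

Lemma scoefD k x y : scoef k (x + y) = scoef k x + scoef k y.
Proof. by rewrite /scoef (lin_D _ _ (lin_sext _)); exact: mcoeffD. Qed.

Lemma scoefZ k c x : scoef k (c *: x) = c * scoef k x.
Proof. by rewrite /scoef (lin_Z _ _ (lin_sext _)); exact: mcoeffZ. Qed.

Lemma scoefN k x : scoef k (- x) = - scoef k x.
Proof. by rewrite -scaleN1r scoefZ mulN1r. Qed.

(** The map [sext mono] into the concrete monoid algebra has [ext smono] as a left inverse, and
    there elements are determined by their coefficients. *)
Lemma scoef_inj x y : (forall k, scoef k x = scoef k y) -> x = y.
Proof.
move=> e; have sextK : cancel (sext (m := A) (@mono C K)) (ext (smono (m := A))).
  apply: (slin_eq (f := fun z => ext (smono (m := A)) (sext (@mono C K) z))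
    (f' := fun z => z)) => [||k]; last by rewrite sextU extU.
  - exact: (lin_comp (lin_ext _) (lin_sext _)).
  - exact: lin_id.
by apply: (can_inj sextK); apply/malgP.
Qed.
End SpecCoefficients.

(** * Bilinearity and multiplicativity of the tensor product *)

Section SpecTensors.
Variables (C : fieldType) (X Y : choiceType).
Variables (A : monoid_algebra_spec C (words X)) (B : monoid_algebra_spec C (words Y)).
Variable S : monoid_algebra_spec C (words2 X Y).
Local Notation "a \tn b" := (@stens C X Y A B S a b)
  (at level 40, left associativity).
Implicit Types (a : A) (b : B) (c : C).

Lemma stensDl a a' b : (a + a') \tn b = a \tn b + a' \tn b.
Proof. exact: (lin_D _ _ (lin_stensl S b)). Qed.

Lemma stensZl c a b : (c *: a) \tn b = c *: (a \tn b).
Proof. exact: (lin_Z _ _ (lin_stensl S b)). Qed.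

Lemma stensDr a b b' : a \tn (b + b') = a \tn b + a \tn b'.
Proof. exact: (lin_D _ _ (lin_stensr S a)). Qed.

Lemma stensZr c a b : a \tn (c *: b) = c *: (a \tn b).
Proof. exact: (lin_Z _ _ (lin_stensr S a)). Qed.

Lemma stensNr a b : a \tn (- b) = - (a \tn b).
Proof. by rewrite -!scaleN1r stensZr. Qed.

Lemma stensM a a' b b' : (a \tn b) * (a' \tn b') = (a * a') \tn (b * b').
Proof.
(* Both sides are linear in each of the four arguments; on words the product of pairs is
   componentwise. *)
apply: (slin_eq (f := fun a => (a \tn b) * (a' \tn b'))
  (f' := fun a => (a * a') \tn (b * b'))) => [||{}a].
- exact/lin_smulr/lin_stensl.
- exact: (lin_comp (lin_stensl S _) (lin_smulr _ (@lin_id _ _))).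
apply: (slin_eq (f := fun b => (_ \tn b) * (a' \tn b'))
  (f' := fun b => (_ * a') \tn (b * b'))) => [||{}b].
- exact/lin_smulr/lin_stensr.
- exact: (lin_comp (lin_stensr S _) (lin_smulr _ (@lin_id _ _))).
apply: (slin_eq (f := fun a' => (_ \tn _) * (a' \tn b'))
  (f' := fun a' => (_ * a') \tn (_ * b'))) => [||{}a'].
- exact/lin_smull/lin_stensl.
- exact: (lin_comp (lin_stensl S _) (lin_smull _ (@lin_id _ _))).
apply: (slin_eq (f := fun b' => (_ \tn _) * (_ \tn b'))
  (f' := fun b' => (_ * _) \tn (_ * b'))) => [||{}b'].
- exact/lin_smull/lin_stensr.
- exact: (lin_comp (lin_stensr S _) (lin_smull _ (@lin_id _ _))).
by rewrite !smonoM !stensUU smonoM.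
Qed.

Lemma stens11 : 1 \tn 1 = 1.
Proof. by rewrite !smono1 stensUU. Qed.
End SpecTensors.

Lemma sum3 (E : nmodType) (F : 'I_3 -> E) :
  \sum_i F i = F ord0 + F (lift ord0 ord0) + F (lift ord0 (lift ord0 ord0)).
Proof. by rewrite !big_ord_recl big_ord0 addr0 addrA. Qed.

(** * Moving products of generators for arbitrary coefficients [c1], [c2], [upd] *)

Section SpecPermutation.
Variables (C : fieldType) (X Y : choiceType).
Variables (c1 c2 : X -> Y -> C) (upd : X -> Y -> X).
Variables (A : monoid_algebra_spec C (words Y)) (B : monoid_algebra_spec C (words X)).
Variables (S : monoid_algebra_spec C (words2 X Y)).
Variables (T : monoid_algebra_spec C (words2 Y X)).
Variable sigma : S -> T.
Hypothesis hsigma : spec_permutation c1 c2 upd A B sigma.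
Implicit Types (x y : X) (l m : Y) (a : B) (b : A) (e f : C).

Local Notation tS a b := (@stens C X Y B A S a b).
Local Notation tT a b := (@stens C Y X A B T a b).
Local Notation p x := (smono (letter x) : B).
Local Notation v l := (smono (letter l) : A).

Let lin_sigmal b : lin (fun a => sigma (tS a b)).
Proof. exact: (lin_comp (sperm_lin hsigma) (lin_stensl S _)). Qed.

Let lin_sigmar a : lin (fun b => sigma (tS a b)).
Proof. exact: (lin_comp (sperm_lin hsigma) (lin_stensr S _)). Qed.

(** The left consecutive rule for three-term results, the shape produced by [sperm_gen]: [a] still
    has to cross [b'], but passes the left factor 1 of the other two terms freely. *)
Lemma sperm_mull a a' b b' e f w w' :
  sigma (tS a' b) = tT b' w + e *: tT 1 1 + f *: tT 1 w' ->
  sigma (tS (a * a') b) =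
  sigma (tS a b') * tT 1 w + e *: tT 1 a + f *: tT 1 (a * w').
Proof.
(* The scalars [e] and [f] go into the left factors; the default 0 of [nth] is never reached. *)
move=> E; rewrite (@sperm_consl _ _ _ _ _ _ _ _ _ _ _ hsigma a a' b 3
  (fun t => nth 0 [:: b'; e *: 1; f *: 1] t) (fun t => nth 0 [:: w; 1; w'] t));
  last by rewrite sum3 /= !stensZl.
rewrite sum3 /= !(lin_Z _ _ (lin_sigmar a)) (sperm_a1 hsigma).
by rewrite -!scalerAl !stensM !mulr1.
Qed.

(** The mirror image: [w] and [w'] still have to cross [b'], which passes the constant term
    freely. *)
Lemma sperm_mulr a b b' b1 e f w w' :
  sigma (tS a b) = tT b1 w + e *: tT 1 1 + f *: tT 1 w' ->
  sigma (tS a (b * b')) =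
  tT b1 1 * sigma (tS w b') + e *: tT b' 1 + f *: sigma (tS w' b').
Proof.
move=> E; rewrite (@sperm_consr _ _ _ _ _ _ _ _ _ _ _ hsigma a b b' 3
  (fun t => nth 0 [:: b1; e *: 1; f *: 1] t) (fun t => nth 0 [:: w; 1; w'] t));
  last by rewrite sum3 /= !stensZl.
by rewrite sum3 /= !stensZl -!scalerAl (sperm_1b hsigma) stens11 !mul1r.
Qed.

(** The [c1] part for the product of [x] and [y] is c1(x, l) (1 (x) y) + c1(y, l) (1 (x) x),
    symmetric in [x] and [y], so it drops out of the commutator. *)
Lemma sperm_commutatorl x y l :
  sigma (tS (p x * p y - p y * p x) (v l)) =
  tT (v l) (p x * p y - p y * p x)
  + c2 x l *: tT 1 (p (upd x l) * p y - p y * p (upd x l))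
  + c2 y l *: tT 1 (p x * p (upd y l) - p (upd y l) * p x).
Proof.
rewrite (lin_D _ _ (lin_sigmal _)) -scaleN1r (lin_Z _ _ (lin_sigmal _)).
rewrite !(sperm_mull _ (sperm_gen hsigma _ _)) !(sperm_gen hsigma).
rewrite !mulrDl -!scalerAl !stensM !mul1r !mulr1 !stensDr !stensNr !stensZr.
by apply: scoef_inj => k; rewrite !(scoefD, scoefN, scoefZ); ring.
Qed.

(** Crossing [l] yields [x], a constant or [upd x l], and each of these then crosses [m]. *)
Lemma sperm_mulr_gen x l m :
  sigma (tS (p x) (v l * v m)) =
  tT (v l * v m) (p x)
  + c1 x m *: tT (v l) 1 + c2 x m *: tT (v l) (p (upd x m))
  + c1 x l *: tT (v m) 1 + c2 x l *: tT (v m) (p (upd x l))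
  + (c2 x l * c1 (upd x l) m) *: tT 1 1
  + (c2 x l * c2 (upd x l) m) *: tT 1 (p (upd (upd x l) m)).
Proof.
rewrite !(sperm_mulr _ (sperm_gen hsigma _ _)) !(sperm_gen hsigma).
rewrite !mulrDr !spec_scalerAr !stensM !mul1r !mulr1.
by apply: scoef_inj => k; rewrite !(scoefD, scoefN, scoefZ); ring.
Qed.
End SpecPermutation.

(** * The relations of U(gl(N)_h) under the permutation *)

Section GlRelations.
Variables (C : fieldType) (N : nat) (h : C).
Variables (A : monoid_algebra_spec C (words (lgen N))).
Variables (B : monoid_algebra_spec C (words (dgen N))).
Variables (S : monoid_algebra_spec C (words2 (dgen N) (lgen N))).
Variables (T : monoid_algebra_spec C (words2 (lgen N) (dgen N))).
Variable sigma : S -> T.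
Hypothesis hsigma :
  spec_permutation (@cst1 C N) (cst2 h) (@upd N) A B sigma.

Local Notation p i j := (smono (letter (DGen i j)) : B).
Local Notation v i j := (smono (letter (LGen i j)) : A).

(** In [sperm_mulr_gen] the terms with a single coefficient are symmetric in the two factors and
    cancel in the commutator. The terms with two coefficients, for the first product, equal h
    [k = j] times the extra terms of l_i^s, and for the second h [i = s] times those of l_k^j; the
    linear part of [r] removes exactly these. *)
Lemma sperm_gl_relation (a b i j k s : 'I_N) :
  let r := v i j * v k s - v k s * v i j
    - h *: ((k == j)%:R *: v i s - (i == s)%:R *: v k j) in
  sigma (stens S (p a b) r) = stens T r (p a b).
Proof.
have sD : lin (fun x : A => sigma (stens S (p a b) x)).
  exact: (lin_comp (sperm_lin hsigma) (lin_stensr S _)).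
rewrite /= -!scaleN1r !(lin_D _ _ sD, lin_Z _ _ sD).
rewrite !(sperm_mulr_gen hsigma) !(sperm_gen hsigma) !(stensDl, stensZl).
(* Conjunctions of index equalities become products of deltas, which [ring] treats as atoms. *)
rewrite /cst1 /cst2 /upd -!mulnb !natrM.
by apply: scoef_inj => m; rewrite !(scoefD, scoefN, scoefZ); ring.
Qed.
End GlRelations.

(** * Spans of matrix entries and tensor products of subspaces *)

Section Spans.
Variable C : fieldType.

Definition subspace (E : lmodType C) (U : E -> Prop) : Prop :=
  U 0 /\ forall c x y, U x -> U y -> U (c *: x + y).

Lemma subspace_sum (E : lmodType C) (U : E -> Prop) (I : Type) (r : seq I)
    (F : I -> E) :
  subspace U -> (forall i, U (F i)) -> U (\sum_(i <- r) F i).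
Proof.
move=> [U0 UD] UF; elim: r => [|i r IHr]; first by rewrite big_nil.
by rewrite big_cons -[F i]scale1r; apply: UD.
Qed.

Lemma entry_span_subspace (E : lmodType C) m n (M : 'M[E]_(m, n)) :
  subspace (entry_span M).
Proof.
split=> [|c x y [a ->] [b ->]].
  by exists 0; rewrite big1 // => i _; rewrite big1 // => j _; rewrite mxE scale0r.
exists (c *: a + b); rewrite scaler_sumr -big_split /=; apply: eq_bigr => i _.
rewrite scaler_sumr -big_split /=; apply: eq_bigr => j _.
by rewrite !mxE scalerDl scalerA.
Qed.

Lemma entry_span_entry (E : lmodType C) m n (M : 'M[E]_(m, n)) i j :
  entry_span M (M i j).
Proof.
exists (delta_mx i j); rewrite (bigD1 i) //= [X in _ + X]big1 => [|p /negPf np].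
  rewrite addr0 (bigD1 j) //= big1 => [|q /negPf nq].
    by rewrite mxE !eqxx scale1r addr0.
  by rewrite mxE nq andbF scale0r.
by rewrite big1 // => q _; rewrite mxE np scale0r.
Qed.

(** Induction principle for spans: a property that cuts out a subspace need only be tested on the
    entries. *)
Lemma entry_span_ind (E : lmodType C) m n (M : 'M[E]_(m, n)) (U : E -> Prop) :
  subspace U -> (forall i j, U (M i j)) -> forall x, entry_span M x -> U x.
Proof.
move=> sU UM x [c ->].
apply: subspace_sum => // i; apply: subspace_sum => // j.
by rewrite -[_ *: _]addr0; apply: sU.2 => //; apply: sU.1.
Qed.

Lemma scale_add_algC (A : lalgType C) (a b c : C) (u v : A) :
  c *: (a%:A + u) + (b%:A + v) = (c * a + b)%:A + (c *: u + v).
Proof. by rewrite scalerDr scalerDl scalerA addrACA. Qed.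

Lemma subspace_add_scalars (X : choiceType) (U : talg C X -> Prop) :
  subspace U -> subspace (add_scalars U).
Proof.
move=> [U0 UD]; split=> [|c x y [a [u [Uu ->]]] [b [v [Uv ->]]]].
  by exists 0, 0; split=> //; rewrite scale0r addr0.
exists (c * a + b), (c *: u + v); split; first exact: UD.
exact: scale_add_algC.
Qed.

Section TensorSubspace.
Variables (X Y : choiceType) (U : talg C X -> Prop) (U' : talg C Y -> Prop).

Lemma tens_sub_tens u u' : U u -> U' u' -> tens_sub U U' (u \ox u').
Proof.
by move=> Uu Uu'; exists 1, (fun=> u), (fun=> u'); split=> //; rewrite big_ord1.
Qed.

Lemma subspace_tens_sub : subspace U -> subspace (tens_sub U U').
Proof.
move=> [U0 UD]; split.
  exists 0, (fun=> 0), (fun=> 0); split=> [[]//|[]//|]; by rewrite big_ord0.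
move=> c x y [m [u [u' [Uu Uu' ->]]]] [n [v [v' [Uv Uv' ->]]]].
(* The two families are concatenated; the scalar is absorbed into the left factors, where closure of
   [U] applies. *)
pose f i := match split i with inl p => c *: u p | inr q => v q end.
pose g i := match split i with inl p => u' p | inr q => v' q end.
exists (m + n)%N, f, g; split=> [i|i|].
- by rewrite /f; case: split => p //; rewrite -[_ *: _]addr0; apply: UD.
- by rewrite /g; case: split.
rewrite big_split_ord scaler_sumr; congr (_ + _); apply: eq_bigr => i _.
  by rewrite /f /g (unsplitK (inl i)) (lin_Z _ _ (lin_tensl _)).
by rewrite /f /g (unsplitK (inr i)).
Qed.
End TensorSubspace.
End Spans.

(** * Entries of the matrix relations *)

Lemma submxE (S : zmodType) m n (A B : 'M[S]_(m, n)) p q :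
  (A - B) p q = A p q - B p q.
Proof. by rewrite !mxE. Qed.

Lemma in1_in2_commE N (S : pzRingType) (M : 'M[S]_N) (i j k s : 'I_N) :
  (in1 M *m in2 M - in2 M *m in1 M) (mxtens_index (i, k)) (mxtens_index (j, s)) =
  M i j * M k s - M k s * M i j.
Proof.
rewrite submxE in1_mulE in2_mulE; congr (_ - _).
  by under eq_bigr do rewrite in2E mulrnAr; rewrite sum_delta.
by under eq_bigr do rewrite in1E mulrnAr; rewrite sum_delta.
Qed.

(** Multiplying by the flip on the right exchanges the upper indices [j] and [s], on the left the
    lower indices [i] and [k]. *)
Lemma in1_flip_commE N (S : pzRingType) (M : 'M[S]_N) (i j k s : 'I_N) :
  (in1 M *m flipmx N S - flipmx N S *m in1 M)
    (mxtens_index (i, k)) (mxtens_index (j, s)) =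
  M i s *+ (k == j) - M k j *+ (i == s).
Proof.
rewrite submxE in1_mulE; congr (_ - _).
  rewrite (bigD1 s) //= big1 => [|q /negPf nq]; last by rewrite flipmxE nq mulr0.
  by rewrite flipmxE eqxx addr0 mulr_natr.
rewrite mxE sum_mxtens (bigD1 k) //= [X in _ + X]big1 => [|q /negPf nq]; last first.
  by rewrite big1 // => t _; rewrite flipmxE [k == q]eq_sym nq andbF mul0r.
rewrite addr0 (bigD1 i) //= big1 => [|q /negPf nq]; last first.
  by rewrite flipmxE [i == q]eq_sym nq mul0r.
by rewrite flipmxE !eqxx mul1r addr0 in1E.
Qed.

Lemma J2_mxE (C : fieldType) N (h : C) (S : lalgType C) (M : 'M[S]_N)
    (i j k s : 'I_N) :
  (in1 M *m in2 M - in2 M *m in1 M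
     - h%:A *: (in1 M *m flipmx N S - flipmx N S *m in1 M))
    (mxtens_index (i, k)) (mxtens_index (j, s)) =
  M i j * M k s - M k s * M i j
    - h *: ((k == j)%:R *: M i s - (i == s)%:R *: M k j).
Proof.
rewrite submxE in1_in2_commE scalemxE in1_flip_commE.
by rewrite -scalerAl mul1r !scaler_nat.
Qed.

(** * Compatibility of [sigma] with both sets of relations *)

Section Compatibility.
Variables (C : fieldType) (N : nat) (h : C).
Variable sigma : {linear TWV C N -> TVW C N}.
Hypothesis hsigma : permutation_map h sigma.
Implicit Types i j k s a b c d : 'I_N.

Let l i j : TV C N := mono C (letter (LGen i j)).
Let p i j : TW C N := mono C (letter (DGen i j)).

Let r1 a b c d : TW C N := p a b * p c d - p c d * p a b.
Let r2 i j k s : TV C N :=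
  l i j * l k s - l k s * l i j - h *: ((k == j)%:R *: l i s - (i == s)%:R *: l k j).

Lemma J1_entry a b c d :
  let D1 := in1 (Dmx C N) in let D2 := in2 (Dmx C N) in
  (D1 *m D2 - D2 *m D1) (mxtens_index (a, c)) (mxtens_index (b, d)) = r1 a b c d.
Proof. by rewrite /= in1_in2_commE !mxE. Qed.

Lemma J2_entry i j k s :
  let L1 := in1 (Lmx C N) in let L2 := in2 (Lmx C N) in
  let P12 := flipmx N (TV C N) in
  (L1 *m L2 - L2 *m L1 - h%:A *: (L1 *m P12 - P12 *m L1))
    (mxtens_index (i, k)) (mxtens_index (j, s)) = r2 i j k s.
Proof. by rewrite /= J2_mxE !mxE. Qed.

Lemma sigma_r1 a b c d k s :
  sigma (r1 a b c d \ox l k s) =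
  l k s \ox r1 a b c d + (h * (k == b)%:R) *: (1 \ox r1 a s c d)
  + (h * (k == d)%:R) *: (1 \ox r1 a b c s).
Proof.
(* Transporting with variables in place of the commutators avoids unfolding
   products in the monoid algebra. *)
pose st (X Y : choiceType) (x : talg C X) (y : talg C Y) : talg2 C X Y :=
  stens (A := ma_spec C (words X)) (B := ma_spec C (words Y))
    (ma_spec C (words2 X Y)) x y.
have st_tens u v x y e f :
  sigma (st _ _ u v) = st _ _ v u + e *: st _ _ 1 x + f *: st _ _ 1 y ->
  sigma (u \ox v) = v \ox u + e *: (1 \ox x) + f *: (1 \ox y).
  by rewrite /st !stens_tens.
apply: st_tens.
exact: (sperm_commutatorl ((permutation_map_spec h sigma).1 hsigma)
  (DGen a b) (DGen c d) (LGen k s)).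
Qed.

Lemma sigma_r2 a b i j k s : sigma (p a b \ox r2 i j k s) = r2 i j k s \ox p a b.
Proof.
rewrite -(stens_tens (p a b) (r2 i j k s)).
rewrite -(stens_tens (r2 i j k s) (p a b)).
exact: (sperm_gl_relation ((permutation_map_spec h sigma).1 hsigma)).
Qed.

Lemma sigma_J1_V x v : J1 C N x -> Vsp C N v ->
  tens_sub (add_scalars (Vsp C N)) (J1 C N) (sigma (x \ox v)).
Proof.
have sV := entry_span_subspace (Lmx C N).
have sT := subspace_tens_sub (J1 C N) (subspace_add_scalars sV).
have J1r a' b' c' d' : J1 C N (r1 a' b' c' d').
  by rewrite -J1_entry; apply: entry_span_entry.
(* The correction terms of [sigma_r1] have left factor 1; this is where the scalars adjoined to V
   enter. *)
have U1 : add_scalars (Vsp C N) 1.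
  by exists 1, 0; split; [exact: sV.1 | rewrite scale1r addr0].
have Ul k s : add_scalars (Vsp C N) (l k s).
  exists 0, (l k s); rewrite scale0r add0r; split=> //.
  by have := entry_span_entry (Lmx C N) k s; rewrite mxE.
move=> Jx; apply: (entry_span_ind (M := Lmx C N)
  (U := fun v => tens_sub _ _ (sigma (x \ox v)))) v.
  split=> [|c v v' Hv Hv']; first by rewrite (lin0 (lin_tensr x)) linear0; apply: sT.1.
  by rewrite lin_tensr linearP; apply: sT.2.
move=> k s; rewrite mxE; move: x Jx; apply: (entry_span_ind
  (U := fun x => tens_sub _ _ (sigma (x \ox l k s)))).
  split=> [|c x x' Hx Hx']; last by rewrite lin_tensl linearP; apply: sT.2.
  by rewrite (lin0 (lin_tensl _)) linear0; apply: sT.1.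
move=> ac bd; case: (mxtens_indexP ac) => a c; case: (mxtens_indexP bd) => b d.
(* [addrC] brings each scaled correction term to the front, the form in which subspace closure is
   stated. *)
rewrite J1_entry sigma_r1 addrC; apply: sT.2; first exact: tens_sub_tens.
by rewrite addrC; apply: sT.2; exact: tens_sub_tens.
Qed.

(** Both sides are bilinear, so [sigma_r2] on generators and relation entries suffices. *)
Lemma sigma_W_J2 w x : Wsp C N w -> J2 C N h x -> sigma (w \ox x) = x \ox w.
Proof.
move=> Ww; move: x; apply: entry_span_ind => [|ik js].
  split=> [|c x y Ex Ey]; last by rewrite lin_tensr lin_tensl linearP /= Ex Ey.
  by rewrite (lin0 (lin_tensr _)) (lin0 (lin_tensl _)) linear0.
case: (mxtens_indexP ik) => i k; case: (mxtens_indexP js) => j s.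
rewrite J2_entry; move: w Ww; apply: entry_span_ind => [|a b].
  split=> [|c x y Ex Ey]; last by rewrite lin_tensr lin_tensl linearP /= Ex Ey.
  by rewrite (lin0 (lin_tensr _)) (lin0 (lin_tensl _)) linear0.
by rewrite mxE sigma_r2.
Qed.
End Compatibility.

Theorem proposition2 (R : realType) (N : nat) (hN : (1 <= N)%N) (h : R[i])
    (sigma : {linear TWV R[i] N -> TVW R[i] N})
    (hsigma : permutation_map h sigma) :
  (forall t, tens_sub (J1 R[i] N) (Vsp R[i] N) t ->
     tens_sub (add_scalars (Vsp R[i] N)) (J1 R[i] N) (sigma t)) /\
  (forall t, tens_sub (Wsp R[i] N) (J2 R[i] N h) t ->
     tens_sub (J2 R[i] N h) (Wsp R[i] N) (sigma t)).
Proof.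
split=> t [n [u [u' [Hu Hu' ->]]]]; rewrite linear_sum.
  apply: subspace_sum => [|i]; last exact: (sigma_J1_V hsigma).
  exact/subspace_tens_sub/subspace_add_scalars/entry_span_subspace.
(* Since [sigma] acts here as the flip, the exchanged families are a decomposition of the image. *)
exists n, u', u; split=> //; apply: eq_bigr => i _; exact: (sigma_W_J2 hsigma).
Qed.
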